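(* Let $n\ge 1$. The excess of the number of parts in all partitions in $\mathcal A_\omega(n)$ over the number of parts in all partitions in $\mathcal B_\omega(n)$, i.e. $\sum_{\mu\in\mathcal A_\omega(n)}\ell(\mu)-\sum_{\mu\in\mathcal B_\omega(n)}\ell(\mu)$, equals the total number of rows containing at least one $2$ in all odd Ferrers diagrams $F=(k,\lambda)$ of size $n$, which is the same as the total number of parts greater than $1$ in $\lambda$, summed over all odd Ferrers diagrams $F=(k,\lambda)$ of size $n$.
   Context: A partition of $n$ is a finite non-increasing sequence (equivalently, multiset) of positive integers, called parts, with sum $n$; $\ell(\mu)$ denotes the number of parts of $\mu$, counted with multiplicity. $\mathcal A_\omega(n)$ is the set of partitions of $n$ whose parts, except for one instance of the largest part, form pairs of consecutive non-negative integers. That is, after removing one copy of the largest part $k$, the remaining multiset of parts is a union of pairs $(j-1,j)$ with $1\le j\le k$ (repetitions allowed); the pair $(0,1)$ is allowed, but $0$ is not considered a part of the partition (so $(0,1)$ contributes a single part $1$). $\mathcal B_\omega(n)$ is the set of partitions of $n$ such that all odd parts are less than twice the smallest part. The $2$-modular Ferrers diagram of a partition $\lambda$ is the left-justified array whose $i$th row has $\lceil \lambda_i/2\rceil$ boxes, all but the first filled with $2$, the first box being filled with $2$ if $\lambda_i$ is even and with $1$ if $\lambda_i$ is odd. An odd Ferrers diagram $F$ is a Ferrers diagram (left-justified rows of weakly decreasing length) filled with $1$'s and $2$'s such that the first row is filled with $1$'s and the remaining rows form the $2$-modular Ferrers diagram of a partition $\lambda$ with all parts odd. If the first row has length $k$,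 $F$ is identified with the pair $(k,\lambda)$; thus $\lambda$ is a (possibly empty) partition into odd parts with all parts at most $2k-1$. The size of $F$ is the sum of all its entries, namely $k+|\lambda|$. *)

(* Defs.v *)
From mathcomp Require Export all_boot all_order all_algebra.
From mathcomp Require Export all_classical.

Set Implicit Arguments.
Unset Strict Implicit.
Unset Printing Implicit Defensive.

Local Open Scope classical_set_scope.
Local Open Scope nat_scope.

(* Parts are listed in non-increasing order, so [head 0 s] is the largest part
   and [last 0 s] the smallest one. *)
Definition is_intpart (s : seq nat) : bool :=
  sorted geq s && all (fun p => 0 < p) s.

Definition intparts (n : nat) : set (seq nat) :=
  [set s | is_intpart s /\ sumn s = n].

(* The parts contributed by the pair (j-1, j); 0 is not a part, so (0, 1)
   contributes only 1. *)
Definition pair_parts (j : nat) : seq nat := [seq p <- [:: j.-1; j] | 0 < p].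

Definition A_omega (n : nat) : set (seq nat) :=
  [set mu | intparts n mu /\
     exists2 js : seq nat,
       all (fun j => 1 <= j <= head 0 mu) js &
       perm_eq (behead mu) (flatten [seq pair_parts j | j <- js])].

Definition B_omega (n : nat) : set (seq nat) :=
  [set mu | intparts n mu /\
     {in mu, forall p, odd p -> p < 2 * last 0 mu}].

(* A filled diagram is the sequence of its rows. *)
Definition two_modular_row (m : nat) : seq nat :=
  (if odd m then 1 else 2) :: nseq (uphalf m).-1 2.

Definition two_modular (lam : seq nat) : seq (seq nat) :=
  [seq two_modular_row m | m <- lam].

Definition is_odd_ferrers (F : seq (seq nat)) : Prop :=
  sorted geq (shape F) /\
  exists k lam, [/\ is_intpart lam, all odd lam &
                    F = nseq k 1 :: two_modular lam].

Definition diagram_size (F : seq (seq nat)) : nat := sumn [seq sumn r | r <- F].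

Definition odd_ferrers (n : nat) : set (seq (seq nat)) :=
  [set F | is_odd_ferrers F /\ diagram_size F = n].

Definition rows_with_2 (F : seq (seq nat)) : nat :=
  count (fun r : seq nat => 2 \in r) F.

(* For k = 0 the truncated bound 2 * k - 1 = 0 forces lam to be empty. *)
Definition odd_ferrers_pairs (n : nat) : set (nat * seq nat) :=
  [set F | [/\ is_intpart F.2, all odd F.2,
               all (fun p => p <= 2 * F.1 - 1) F.2 & F.1 + sumn F.2 = n]].

Definition parts_gt1 (lam : seq nat) : nat := count (fun p => 1 < p) lam.

(* A sum [\sum_(x \in A) f x] over a set is 0 by convention when f has infinite
   support on A; the lemmas below show that this never happens here. *)
Lemma finite_intparts (n : nat) : finite_set (intparts n).
Proof.
have fin : finite_set [set: n.-bseq 'I_n.+1] by exact: finite_finset.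
apply: (sub_finite_set _
  (finite_image (fun t : n.-bseq 'I_n.+1 => [seq val i | i <- t]) fin)).
move=> s [/andP[_ s_gt0] sn].
have le_p p : p \in s -> p <= n.
  rewrite -sn; elim: s {s_gt0 sn} => //= a s IHs; rewrite inE.
  by case/predU1P=> [->|/IHs le_ps]; [exact: leq_addr | exact: leq_trans (leq_addl _ _)].
have sz_s : size s <= n.
  rewrite -sn; elim: s s_gt0 {sn le_p} => //= a s IHs /andP[a_gt0 /IHs le_s].
  by rewrite -add1n leq_add.
have sz_t : size [seq inord p : 'I_n.+1 | p <- s] <= n by rewrite size_map.
exists (Bseq sz_t) => //=; rewrite -map_comp -[RHS]map_id.
by apply/eq_in_map => p /le_p le_pn /=; rewrite inordK.
Qed.

Lemma finite_A_omega (n : nat) : finite_set (A_omega n).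
Proof. by apply: sub_finite_set (finite_intparts n) => mu []. Qed.

Lemma finite_B_omega (n : nat) : finite_set (B_omega n).
Proof. by apply: sub_finite_set (finite_intparts n) => mu []. Qed.

Lemma finite_bounded_pairs (n : nat) :
  finite_set [set F : nat * seq nat | is_intpart F.2 /\ F.1 + sumn F.2 = n].
Proof.
have fin : finite_set (\bigcup_(m in `I_n.+1) intparts m).
  by apply: bigcup_finite => [|m _]; [exact: finite_II | exact: finite_intparts].
apply: sub_finite_set (finite_setX (finite_II n.+1) fin) => -[k lam] /= [lamP <-].
split=> /=; first by rewrite ltnS leq_addr.
by exists (sumn lam) => //=; rewrite ltnS leq_addl.
Qed.

Lemma finite_odd_ferrers_pairs (n : nat) : finite_set (odd_ferrers_pairs n).
Proof. by apply: sub_finite_set (finite_bounded_pairs n) => F []. Qed.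

Lemma sumn_two_modular_row (m : nat) : 0 < m -> sumn (two_modular_row m) = m.
Proof.
case: m => // m _; rewrite /two_modular_row /= sumn_nseq mul2n.
rewrite -[in RHS](odd_double_half m); case: (odd m) => //=.
Qed.

Lemma finite_odd_ferrers (n : nat) : finite_set (odd_ferrers n).
Proof.
apply: (sub_finite_set _ (finite_image
  (fun F : nat * seq nat => nseq F.1 1 :: two_modular F.2)
  (finite_bounded_pairs n))).
move=> _ [[_ [k [lam [lamP _ ->]]]] sz_n]; exists (k, lam) => //=; split=> //.
rewrite -sz_n /diagram_size /= sumn_nseq mul1n -map_comp; congr (_ + sumn _).
rewrite -[LHS]map_id; apply/eq_in_map => p p_lam.
by apply/esym/sumn_two_modular_row; case/andP: lamP => _ /allP/(_ p p_lam).
Qed.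

(* Main.v *)
Require Import Defs.
From mathcomp Require Import all_boot all_order all_algebra.
From mathcomp Require Import all_classical.
From mathcomp Require Import zify lra.
Import GRing.Theory.

Local Open Scope ring_scope.

(** Write a partition in B_omega(n) as its smallest part k together with the
    multiset of its other parts; these are the p >= k that are even or smaller
    than 2k ([B_part k]).  Likewise an odd Ferrers diagram is a number k with a
    multiset of odd parts smaller than 2k ([ferrers_part k]).  A partition in
    A_omega(n) with largest part k is a k with a multiset of pairs (j-1, j),
    j <= k; since the pair (j-1, j) has sum 2j-1, replacing each pair by its sum
    turns it into the odd Ferrers diagram (k, lambda), and it has
    1 + l(lambda) + (number of parts of lambda greater than 1) parts, because
    only the pair (0, 1) contributes a single part ([sum_A_omega]).

    So the theorem amounts to saying that the partitions in B_omega(n) have as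
    many parts in total as the odd Ferrers diagrams of size n have rows.  In
    fact, for each m there are as many partitions in B_omega(n) with m + 1 parts
    as diagrams with m + 1 rows.  Both numbers, as functions u(m, N) of m and of
    the size N, agree for m = 0 and obey

      u(m + 1, N) = u(m, N - 1) + u(m + 1, N - (2m + 3)),

    that is, the two generating functions G(z) with z marking m both satisfy
    (1 - zq) G(z) = q + q G(z q^2).  For diagrams ([nrooted_ferrers_rec]) one
    either removes a part 1, or lowers k by 1 and all m + 1 parts by 2.  For
    B_omega ([nrooted_B_rec]) one compares the sets of allowed parts for k and
    k + 1, and a telescoping sum over k takes care of the discrepancy. *)

(** * Sequences in non-increasing order *)

Lemma geq_total : total geq.
Proof. by move=> x y; exact: leq_total. Qed.

Lemma geq_trans : transitive geq.
Proof. by move=> x y z /= yx zy; apply: leq_trans zy yx. Qed.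

Lemma geq_anti : antisymmetric geq.
Proof. by move=> x y /=; rewrite andbC => /anti_leq. Qed.

Lemma perm_sorted_geq s t : sorted geq s -> sorted geq t -> perm_eq s t -> s = t.
Proof. exact: (sorted_eq geq_trans geq_anti). Qed.

Lemma sort_geqP s t : sort geq s = sort geq t -> perm_eq s t.
Proof. by move/perm_sortP; apply; [exact: geq_total|exact: geq_trans|exact: geq_anti]. Qed.

(** * Counting multisets of given size and sum *)

(** The sum N is an integer, so that N may be decreased past 0 freely: there are
    no multisets with a negative sum. *)
Definition multisets (P : pred nat) (m : nat) (N : int) : set (seq nat) :=
  [set s | [/\ sorted geq s, all P s, size s = m & (sumn s)%:Z = N]]%classic.

Definition nmultisets P m N : int := \sum_(s \in multisets P m N) (1 : int).

Lemma sumn_map_addn d s : sumn (map (addn d) s) = (d * size s + sumn s)%N.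
Proof. by elim: s => //= [|a s ->]; [rewrite muln0 | lia]. Qed.

Lemma sorted_map_addn d s : sorted geq (map (addn d) s) = sorted geq s.
Proof. by rewrite sorted_map; apply: eq_sorted => x y /=; rewrite leq_add2l. Qed.

Lemma finite_multisets P m N : finite_set (multisets P m N).
Proof.
have sub : (multisets P m N `<=` map succn @^-1` intparts (m + `|N|))%classic.
  move=> s [ss _ sz sN]; split.
    rewrite /is_intpart (sorted_map_addn 1) ss /=.
    by apply/allP => _ /mapP[p _ ->].
  by rewrite (sumn_map_addn 1); lia.
apply: sub_finite_set sub _; apply: finite_preimage (finite_intparts _).
by move=> s t _ _; apply: inj_map; exact: succn_inj.
Qed.

Lemma nmultisets_eq0 P m N :
  (forall s, multisets P m N s -> False) -> nmultisets P m N = 0.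
Proof. by move=> P0; apply: fsbig1 => s /P0. Qed.

Lemma nmultisets_lt0 P m N : N < 0 -> nmultisets P m N = 0.
Proof. by move=> N0; apply: nmultisets_eq0 => s [_ _ _]; lia. Qed.

Lemma nmultisets_size0 P Q N : nmultisets P 0 N = nmultisets Q 0 N.
Proof.
apply: eq_fsbigl; apply/seteqP.
by split=> s [ss _ /size0nil s0 sN]; split; rewrite ?s0 //; rewrite s0 in sN.
Qed.

Lemma nmultisets_small (P : pred nat) m (N : int) :
  (forall p, P p -> N < p%:Z) -> nmultisets P m.+1 N = 0.
Proof.
move=> PN; apply: nmultisets_eq0 => -[|a s] [_ //= /andP[/PN aN _] _].
by lia.
Qed.

(** A multiset over {x} + Q either avoids x or is obtained by adding one copy of
    x to a multiset over {x} + Q with one element less. *)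
Lemma nmultisets_insert (P Q : pred nat) x m N :
    (forall p, P p = (p == x) || Q p) -> ~~ Q x ->
  nmultisets P m.+1 N = nmultisets Q m.+1 N + nmultisets P m (N - x%:Z).
Proof.
move=> PE Qx; pose ins s := sort geq (x :: s).
have perm_ins s : perm_eq (ins s) (x :: s) by rewrite /ins perm_sort.
have split_set : multisets P m.+1 N
    = (multisets Q m.+1 N `|` ins @` multisets P m (N - x%:Z))%classic.
  apply/seteqP; split=> s.
    case=> ss sP sz sN; have [xs|xs] := boolP (x \in s); [right|left].
      have srem := perm_to_rem xs; exists (rem x s).
        split; first exact: (subseq_sorted geq_trans (rem_subseq _ _)).
        - by apply/allP => p /mem_rem; apply/allP.
        - by rewrite size_rem // sz.
        - by rewrite -sN (perm_sumn srem) /=; lia.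
      apply: perm_sorted_geq => //; first exact/sort_sorted/geq_total.
      by rewrite (permPl (perm_ins _)) perm_sym.
    split=> //; apply/allP => p ps; have := allP sP p ps.
    by rewrite PE => /predU1P[px|//]; rewrite -px ps in xs.
  case=> [[ss sQ sz sN]|[t [st tP sz sN] <-]].
    by split=> //; apply: sub_all sQ => p Qp; rewrite PE Qp orbT.
  split; first exact/sort_sorted/geq_total.
  - by rewrite (perm_all _ (perm_ins _)) /= tP PE eqxx.
  - by rewrite (perm_size (perm_ins _)) /= sz.
  - by rewrite (perm_sumn (perm_ins _)) /=; lia.
rewrite /nmultisets split_set fsbigU0; last 1 first.
- move=> s [[_ /allP sQ _ _] [t _ ts]]; move/negP: Qx; apply; apply: sQ.
  by rewrite -ts (perm_mem (perm_ins _)) mem_head.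
- congr (_ + _); apply: fsbig_image => s t.
  rewrite !inE => -[ss _ _ _] [st _ _ _] /sort_geqP.
  by rewrite perm_cons; apply: perm_sorted_geq.
- exact: finite_multisets.
- exact/finite_image/finite_multisets.
Qed.

Lemma nmultisets_shift (P Q : pred nat) d m N :
    (forall p, P p = (d <= p)%N && Q (p - d)%N) ->
  nmultisets P m N = nmultisets Q m (N - (d * m)%:Z).
Proof.
move=> PE.
have -> : nmultisets P m N
    = \sum_(s \in (map (addn d) @` multisets Q m (N - (d * m)%:Z))%classic) (1 : int).
  apply: eq_fsbigl; apply/seteqP; split=> s.
    case=> ss sP sz sN.
    have sE : s = map (addn d) (map (subn^~ d) s).
      rewrite -map_comp -[LHS]map_id; apply/eq_in_map => p ps /=.
      by have := allP sP p ps; rewrite PE => /andP[dp _]; rewrite subnKC.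
    exists (map (subn^~ d) s); last by rewrite -sE.
    split; last 1 first.
    - by rewrite -sN -sz {2}sE sumn_map_addn size_map; lia.
    - by rewrite -(sorted_map_addn d) -sE.
    - apply/allP => _ /mapP[p ps ->].
      by have := allP sP p ps; rewrite PE => /andP[].
    - by rewrite size_map.
  case=> t [st tQ sz tN] <-; split.
  - by rewrite sorted_map_addn.
  - apply/allP => _ /mapP[p pt ->].
    by rewrite PE leq_addr addKn (allP tQ p pt).
  - by rewrite size_map.
  - by rewrite sumn_map_addn sz; lia.
by apply: fsbig_image => s t _ _; apply: inj_map; exact: addnI.
Qed.

(** * The recurrence for rooted multisets *)

Definition B_part k p := (k <= p)%N && (odd p ==> (p < 2 * k)%N).
(** [B_part_gt k] links the sets [B_part k] for successive k: adding k to it gives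
    [B_part k], adding 2k + 1 gives [B_part k.+1], and translating
    [B_part k] by 2 gives [B_part_gt k.+1]. *)
Definition B_part_gt k p := (k < p)%N && (odd p ==> (p < 2 * k)%N).
Definition ferrers_part k p := odd p && (p < 2 * k)%N.

(** The number of pairs of a root k > 0 and a multiset of m elements of [X k],
    of total sum N, under the restriction k <= D.  The restriction only keeps the
    sum over k finite; it is void as soon as N <= D. *)
Definition nrooted (X : nat -> pred nat) D m N : int :=
  \sum_(0 <= k < D) nmultisets (X k.+1) m (N - k.+1%:Z).

Lemma nrooted_lt0 X D m N : N < 0 -> nrooted X D m N = 0.
Proof. by move=> N0; apply: big1 => k _; apply: nmultisets_lt0; lia. Qed.

Lemma nrooted_size0 X Y D N : nrooted X D 0 N = nrooted Y D 0 N.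
Proof. by apply: eq_bigr => k _; exact: nmultisets_size0. Qed.

(** The missing last term, for k = D, counts multisets of negative sum. *)
Lemma sum_shift (X : nat -> pred nat) D m (N : int) : N < D%:Z ->
  \sum_(0 <= k < D) nmultisets (X k) m (N - k.+1%:Z)
    = nmultisets (X 0) m (N - 1) + nrooted X D m (N - 1).
Proof.
case: D => [|D] ND.
  by rewrite /nrooted !big_nil nmultisets_lt0 //; lia.
rewrite /nrooted big_nat_recl //= big_nat_recr //=.
rewrite (@nmultisets_lt0 _ _ (_ - D.+1%:Z)); last by lia.
by rewrite addr0; congr (_ + _); apply: eq_bigr => k _; congr nmultisets; lia.
Qed.

(** The odd numbers below 2k + 2 are 1 and the translates by 2 of the odd numbers
    below 2k: a multiset over them contains 1, or is a translate. *)
Lemma nrooted_ferrers_rec D m (N : int) : N < D%:Z ->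
  nrooted ferrers_part D m.+1 N
    = nrooted ferrers_part D m (N - 1)
      + nrooted ferrers_part D m.+1 (N - (2 * m + 3)%:Z).
Proof.
move=> ND.
have step k M : nmultisets (ferrers_part k.+1) m.+1 M
    = nmultisets (ferrers_part k) m.+1 (M - (2 * m.+1)%:Z)
      + nmultisets (ferrers_part k.+1) m (M - 1).
  pose Q p := ferrers_part k.+1 p && (2 <= p)%N.
  rewrite -(@nmultisets_shift Q); last by move=> p; rewrite /Q /ferrers_part; lia.
  by apply: nmultisets_insert => [p|]; rewrite /Q /ferrers_part; lia.
rewrite {1}/nrooted (eq_bigr _ (fun k _ => step k _)) big_split /= addrC.
congr (_ + _).
  by apply: eq_bigr => k _; congr nmultisets; lia.
under eq_bigr do rewrite addrAC.
rewrite sum_shift; last by lia.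
rewrite nmultisets_eq0 ?add0r; last first.
  by case=> [|a s] [_ //=]; rewrite /ferrers_part ltn0 andbF.
by congr nrooted; lia.
Qed.

(** Split off the smallest allowed part k: the multisets that avoid it are
    translates by 2 for the root k - 1, which yields the last term of the
    recurrence together with a boundary term for the root 0; those that contain
    it contribute the sum T.  Subtracting the two ways of building
    [B_part k.+1], from [B_part_gt k] and from [B_part_gt k.+1], telescopes over
    k and shows that the boundary term is [nrooted B_part D m (N - 1) - T]. *)
Lemma nrooted_B_rec D m (N : int) : N < D%:Z ->
  nrooted B_part D m.+1 N
    = nrooted B_part D m (N - 1) + nrooted B_part D m.+1 (N - (2 * m + 3)%:Z).
Proof.
move=> ND.
have add_min k M : nmultisets (B_part k.+1) m.+1 M
    = nmultisets (B_part_gt k.+1) m.+1 M + nmultisets (B_part k.+1) m (M - k.+1%:Z).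
  by apply: nmultisets_insert => [p|]; rewrite /B_part /B_part_gt; lia.
have add_odd k M : nmultisets (B_part k.+1) m.+1 M
    = nmultisets (B_part_gt k) m.+1 M + nmultisets (B_part k.+1) m (M - (2 * k).+1%:Z).
  by apply: nmultisets_insert => [p|]; rewrite /B_part /B_part_gt; lia.
have shift k M : nmultisets (B_part_gt k.+1) m.+1 M
    = nmultisets (B_part k) m.+1 (M - (2 * m.+1)%:Z).
  by apply: nmultisets_shift => p; rewrite /B_part /B_part_gt; lia.
pose T : int := \sum_(0 <= k < D) nmultisets (B_part k.+1) m (N - 1 - (2 * k).+1%:Z).
have telescope : nmultisets (B_part_gt 0) m.+1 (N - 1) = nrooted B_part D m (N - 1) - T.
  rewrite /nrooted /T -sumrB.
  pose f k : int := - nmultisets (B_part_gt k) m.+1 (N - 1).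
  rewrite (eq_bigr (fun k => f k.+1 - f k)); last first.
    move=> k _; rewrite /f.
    have := add_min k (N - 1); rewrite (add_odd k (N - 1)).
    by lra.
  (* The upper end vanishes: all parts exceed D, which exceeds N. *)
  rewrite telescope_sumr // /f (@nmultisets_small (B_part_gt D)); last first.
    by move=> p; rewrite /B_part_gt; lia.
  by lia.
(* For k = 0 and k = 1 the predicate [B_part_gt k] is the same: both hold exactly
   for the positive even numbers, the translates by 2 of all even numbers. *)
have first_term : nmultisets (B_part 0) m.+1 (N - 1 - (2 * m.+1)%:Z)
    = nmultisets (B_part_gt 0) m.+1 (N - 1).
  rewrite -shift; congr nmultisets; apply/funext => p.
  by rewrite /B_part_gt; lia.
rewrite {1}/nrooted (eq_bigr _ (fun k _ => add_min k _)) big_split /=.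
rewrite (eq_bigr (fun k => nmultisets (B_part k) m.+1 (N - (2 * m.+1)%:Z - k.+1%:Z)));
  last by move=> k _; rewrite shift; congr nmultisets; lia.
rewrite sum_shift; last by lia.
have -> : N - (2 * m.+1)%:Z - 1 = N - 1 - (2 * m.+1)%:Z by lia.
rewrite first_term telescope.
have -> : \sum_(0 <= k < D) nmultisets (B_part k.+1) m (N - k.+1%:Z - k.+1%:Z) = T.
  by apply: eq_bigr => k _; congr nmultisets; lia.
have -> : N - 1 - (2 * m.+1)%:Z = N - (2 * m + 3)%:Z by lia.
by lia.
Qed.

(** Induction on m, and for fixed m on N, since 2m + 3 > 0. *)
Lemma recurrence_unique (u v : nat -> int -> int) (D : nat) :
    (forall N, u 0 N = v 0 N) ->
    (forall m (N : int), N < 0 -> u m N = v m N) ->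
    (forall m (N : int), N < D%:Z ->
      u m.+1 N = u m (N - 1) + u m.+1 (N - (2 * m + 3)%:Z)) ->
    (forall m (N : int), N < D%:Z ->
      v m.+1 N = v m (N - 1) + v m.+1 (N - (2 * m + 3)%:Z)) ->
  forall m (N : int), N < D%:Z -> u m N = v m N.
Proof.
move=> uv0 uvneg urec vrec; elim=> [//|m IHm] N.
have [j] := ubnP `|N|%N; elim: j N => // j IHj N Nj ND.
have [N0|N0] := Num.Theory.ltrP N 0; first exact: uvneg.
rewrite urec // vrec // IHm; last by lia.
congr (_ + _).
have [M0|M0] := Num.Theory.ltrP (N - (2 * m + 3)%:Z) 0; first exact: uvneg.
by apply: IHj; lia.
Qed.

Lemma nrooted_B_ferrers D m (N : int) :
  N < D%:Z -> nrooted B_part D m N = nrooted ferrers_part D m N.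
Proof.
apply: recurrence_unique => {m N}.
- by move=> N; apply: nrooted_size0.
- by move=> m N N0; rewrite !nrooted_lt0.
- exact: nrooted_B_rec.
- exact: nrooted_ferrers_rec.
Qed.

(** * Sums over rooted multisets *)

Lemma fsbig_fiber (T : choiceType) (A : set T) (g : T -> nat) D (f : T -> int) :
    finite_set A -> (forall x, A x -> (g x < D)%N) ->
  \sum_(x \in A) f x
    = \sum_(0 <= m < D) \sum_(x \in (A `&` [set x | g x = m])%classic) f x.
Proof.
move=> Afin gD; rewrite fsbig_finite //=.
under [RHS]eq_bigr do rewrite fsbig_mkcondr fsbig_finite //.
rewrite exchange_big /=; apply: eq_big_seq => x; rewrite in_fset_set // inE => Ax.
rewrite (bigD1_seq (g x)) ?iota_uniq ?mem_index_iota ?gD //=.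
rewrite ifT ?inE // big1 ?addr0 // => m gm; rewrite ifF //.
by apply/negP; rewrite inE => /= xm; rewrite xm eqxx in gm.
Qed.

Definition rooted_pairs (X : nat -> pred nat) (n : nat) : set (nat * seq nat) :=
  [set F | [/\ (0 < F.1)%N, sorted geq F.2, all (X F.1) F.2
             & (F.1 + sumn F.2)%N = n]]%classic.

(** Only roots k > 0 matter: [B_part 0] allows the part 0. *)
Definition positive_parts (X : nat -> pred nat) :=
  forall k p, (0 < k)%N -> X k p -> (0 < p)%N.

Lemma rooted_pairs_intpart X n F :
  positive_parts X -> rooted_pairs X n F -> is_intpart F.2.
Proof.
move=> X_gt0 [k0 sF aF _]; rewrite /is_intpart sF /=.
by apply: sub_all aF => p; exact: X_gt0.
Qed.

Lemma finite_rooted_pairs X n :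
  positive_parts X -> finite_set (rooted_pairs X n).
Proof.
move=> X_gt0; apply: sub_finite_set (finite_bounded_pairs n) => F FP; split.
  exact: rooted_pairs_intpart X_gt0 FP.
by case: FP.
Qed.

(** Here the bound n.+1 on the roots is harmless, since a root is at most n; the
    fibres over the root k.+1 are indexed by its predecessor. *)
Lemma card_rooted_pairs X n m : positive_parts X ->
  \sum_(F \in (rooted_pairs X n `&` [set F | size F.2 = m])%classic) (1 : int)
    = nrooted X n.+1 m n%:Z.
Proof.
move=> X_gt0; rewrite (@fsbig_fiber _ _ (fun F => F.1.-1) n.+1) /=; last 2 first.
- by apply: finite_setIl; exact: finite_rooted_pairs.
- by move=> F [[F0 _ _ Fn] _]; lia.
apply: eq_bigr => k _.
rewrite /nmultisets -(fsbig_image (multisets _ _ _) (pair k.+1) (fun=> 1)); last first.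
  by move=> s t _ _ [].
apply: eq_fsbigl; apply/seteqP; split=> -[j s] /=.
  case=> -[[/= j0 sF aF Fn] sz] jk; have jE : j = k.+1 by lia.
  by subst j; exists s => //; split=> //; lia.
by case=> t [st tP sz tN] [<- <-]; do !split=> //=; lia.
Qed.

Lemma sum_rooted_pairs X n (f : nat -> int) : positive_parts X ->
  \sum_(F \in rooted_pairs X n) f (size F.2)
    = \sum_(0 <= m < n.+1) f m * nrooted X n.+1 m n%:Z.
Proof.
move=> X_gt0; rewrite (@fsbig_fiber _ _ (fun F => size F.2) n.+1); last 2 first.
- exact: finite_rooted_pairs.
- move=> F FP; have /andP[_ pos] := rooted_pairs_intpart _ _ _ X_gt0 FP.
  case: FP => _ _ _ <-; rewrite ltnS; apply: leq_trans (leq_addl _ _).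
  by elim: F.2 pos => //= a s IHs /andP[a0 /IHs]; lia.
apply: eq_bigr => m _; rewrite -card_rooted_pairs // mulr_fsumr.
by apply: eq_fsbigr => F; rewrite inE mulr1 => -[_ /= ->].
Qed.

(** The two families of rooted multisets are equinumerous for each number m of
    non-root parts, so they give the same sum to any statistic of m. *)
Lemma sum_rooted_pairs_B_ferrers n (f : nat -> int) :
  \sum_(F \in rooted_pairs B_part n) f (size F.2)
    = \sum_(F \in rooted_pairs ferrers_part n) f (size F.2).
Proof.
have B_part_gt0 : positive_parts B_part by move=> k p; rewrite /B_part; lia.
have ferrers_part_gt0 : positive_parts ferrers_part by move=> k [].
rewrite (sum_rooted_pairs _ _ _ B_part_gt0) (sum_rooted_pairs _ _ _ ferrers_part_gt0).
by apply: eq_bigr => m _; rewrite nrooted_B_ferrers //; lia.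
Qed.

(** * The partitions in B_omega *)

(** For n > 0 a pair with k = 0 would have an empty lambda and size 0. *)
Lemma odd_ferrers_pairsE n : (0 < n)%N ->
  odd_ferrers_pairs n = rooted_pairs ferrers_part n.
Proof.
move=> n0; apply/seteqP; split=> -[k lam] /=.
  case=> /andP[slam plam] olam llam kn; split=> //=.
    case: (posnP k) => // k0; subst k.
    by case: lam {slam olam} plam llam kn => [|[|a] s] //= _ _; lia.
  apply/allP => p pl; rewrite /ferrers_part (allP olam p pl) /=.
  by have /= := allP llam p pl; have /= := allP plam p pl; lia.
case=> /= k0 slam alam kn; split=> //=.
- rewrite /is_intpart slam /=.
  by apply: sub_all alam => -[].
- by apply: sub_all alam => p /andP[].
- by apply: sub_all alam => p /andP[]; lia.
Qed.

(** The root is the smallest part, which stands last in a non-increasing list. *)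
Lemma sum_B_omega n (f : nat -> int) : (0 < n)%N ->
  \sum_(mu \in B_omega n) f (size mu)
    = \sum_(F \in rooted_pairs B_part n) f (size F.2).+1.
Proof.
move=> n0.
rewrite (@reindex_fsbig _ _ _ _ _ (fun F => rcons F.2 F.1) (rooted_pairs B_part n)).
  by apply: eq_fsbigr => F _; rewrite size_rcons.
split.
- move=> [k s] /= [k0 ss sk kn]; split.
    split; last by rewrite sumn_rcons addnC.
    rewrite /is_intpart all_rcons k0 /=; apply/andP; split; last first.
      by apply: sub_all sk => p; rewrite /B_part; lia.
    move: ss; rewrite !(sorted_pairwise geq_trans) pairwise_rcons => ->.
    by rewrite andbT; apply: sub_all sk => p /andP[].
  move=> p; rewrite last_rcons mem_rcons inE => /predU1P[->|ps]; first by lia.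
  by have /andP[_ /implyP] := allP sk p ps.
- by move=> [k s] [j t] _ _ /= /rcons_inj[-> ->].
- move=> mu [[/andP[smu pmu] sn] mumin].
  case/lastP: mu smu pmu sn mumin => [|s k]; first by move=> _ _ /= sn; lia.
  rewrite (sorted_pairwise geq_trans) pairwise_rcons all_rcons sumn_rcons last_rcons.
  move=> /andP[sk ss] /andP[k0 s0] sn min_s.
  exists (k, s) => //; split=> //=; last by rewrite addnC.
    by rewrite (sorted_pairwise geq_trans).
  apply/allP => p ps; have /= kp := allP sk p ps; rewrite /B_part kp /=.
  by apply/implyP; apply: min_s; rewrite mem_rcons inE ps orbT.
Qed.

(** * The partitions in A_omega *)

Definition pairs_union (js : seq nat) := flatten [seq pair_parts j | j <- js].

(** A positive j occurs in the pairs (j-1, j) and (j, j+1) only. *)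
Lemma count_pairs_union js j : (0 < j)%N ->
  count_mem j (pairs_union js) = (count_mem j js + count_mem j.+1 js)%N.
Proof.
move=> j0; elim: js => //= i js IHjs; rewrite count_cat IHjs /pair_parts /=.
by case: i => [|[|i]] /=; lia.
Qed.

(** The multiset of pairs can be read off from its union from the top down: once
    the number of pairs (j, j+1) is known, the multiplicity of j determines that
    of (j-1, j).  The induction starts above all indices, where there are no
    pairs at all; the sum of all the indices is a convenient upper bound. *)
Lemma perm_pairs_union js js' :
    all (leq 1) js -> all (leq 1) js' ->
    perm_eq (pairs_union js) (pairs_union js') -> perm_eq js js'.
Proof.
move=> js0 js'0 eq_union.
have count_eq d : forall j, (0 < j)%N -> (sumn js + sumn js' < j + d)%N ->
    count_mem j js = count_mem j js'.
  elim: d => [|d IHd] j j0 jd.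
    have big s : (sumn s < j)%N -> count_mem j s = 0%N.
      move=> sj; apply/count_memPn; apply: contraL sj => js_j.
      by rewrite -leqNgt (perm_sumn (perm_to_rem js_j)) leq_addr.
    by rewrite !big //; lia.
  have := count_pairs_union js j j0.
  by rewrite (permP eq_union) count_pairs_union // (IHd j.+1) //; lia.
apply/allP => -[|j] _ /=; last first.
  by apply/eqP; apply: (count_eq (sumn js + sumn js').+1); lia.
have no0 s : all (leq 1) s -> count_mem 0%N s = 0%N.
  by move=> s0; apply/count_memPn/negP => /(allP s0).
by rewrite !no0.
Qed.

(** The sum of the pair (j-1, j), for j > 0; its inverse is [uphalf]. *)
Definition pair_sum (j : nat) := (2 * j - 1)%N.

Lemma uphalf_oddK p : odd p -> pair_sum (uphalf p) = p.
Proof. by rewrite /pair_sum; lia. Qed.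

Lemma pair_sumK j : (0 < j)%N -> uphalf (pair_sum j) = j.
Proof. by rewrite /pair_sum; lia. Qed.

Lemma sumn_pairs_union lam : all odd lam ->
  sumn (pairs_union (map uphalf lam)) = sumn lam.
Proof.
elim: lam => //= p lam IHlam /andP[po /IHlam IH].
rewrite /pairs_union /= sumn_cat -/(pairs_union _) IH.
rewrite /pair_parts; congr (_ + _)%N.
by case: p po => [|[|[|p]]] //= po; lia.
Qed.

(** A pair contributes two parts, except (0, 1), whose sum is 1. *)
Lemma size_pairs_union lam : all odd lam ->
  size (pairs_union (map uphalf lam)) = (size lam + parts_gt1 lam)%N.
Proof.
elim: lam => //= p lam IHlam /andP[po /IHlam IH].
rewrite /pairs_union /= size_cat -/(pairs_union _) IH.
by case: p po => [|[|[|p]]] //= po; rewrite /pair_parts /=; lia.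
Qed.

Lemma mem_pairs_union js p : p \in pairs_union js ->
  exists2 j, j \in js & (0 < p <= j)%N.
Proof.
case/flatten_mapP => j jjs; rewrite mem_filter !inE => /andP[p0 pj].
by exists j => //; lia.
Qed.

(** The diagram (k, lambda) corresponds to the partition with largest part k whose
    other parts come from the pairs with sums the parts of lambda.  The bound
    2j - 1 <= 2k - 1 on the parts of lambda is the bound j <= k on the pairs. *)
Lemma sum_A_omega n (f : nat -> int) : (0 < n)%N ->
  \sum_(mu \in A_omega n) f (size mu)
    = \sum_(F \in odd_ferrers_pairs n) f (size F.2 + parts_gt1 F.2).+1.
Proof.
move=> n0; pose h (F : nat * seq nat) := F.1 :: sort geq (pairs_union (map uphalf F.2)).
have hperm F : perm_eq (behead (h F)) (pairs_union (map uphalf F.2)).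
  by rewrite /h /= perm_sort.
rewrite (@reindex_fsbig _ _ _ _ _ h (odd_ferrers_pairs n)).
  apply: eq_fsbigr => F; rewrite inE => -[_ oF _ _].
  by rewrite -size_pairs_union // -(perm_size (hperm F)).
split.
- move=> [k lam] /=; rewrite odd_ferrers_pairsE // => -[/= k0 slam alam kn].
  have olam : all odd lam by apply: sub_all alam => p /andP[].
  have jle : all (fun j => (1 <= j <= k)%N) (map uphalf lam).
    by rewrite all_map; apply: sub_all alam => p /andP[po pk] /=; lia.
  have ple p : p \in pairs_union (map uphalf lam) -> (0 < p <= k)%N.
    by case/mem_pairs_union => j /(allP jle); lia.
  split; last by exists (map uphalf lam).
  split; last by rewrite /= (perm_sumn (hperm (k, lam))) sumn_pairs_union.
  rewrite /is_intpart /= k0 path_min_sorted ?(sort_sorted geq_total) /=.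
    by apply/allP => p; rewrite mem_sort => /ple /andP[].
  by apply/allP => p; rewrite mem_sort => /ple /andP[].
- move=> [k lam] [j mu]; rewrite !inE.
  move=> [/= /andP[slam _] olam _ _] [/= /andP[smu _] omu _ _].
  case=> -> /sort_geqP/perm_pairs_union eq_js; congr pair.
  apply: perm_sorted_geq => //.
  have map_id s : all odd s -> map pair_sum (map uphalf s) = s.
    move=> os; rewrite -map_comp -[RHS]map_id; apply/eq_in_map => p ps /=.
    exact/uphalf_oddK/(allP os).
  rewrite -(map_id lam) // -(map_id mu) //; apply/perm_map/eq_js.
    by rewrite all_map; apply: sub_all olam => -[].
  by rewrite all_map; apply: sub_all omu => -[].
- move=> [|k s] [[/andP[smu pmu] sn]] /=; first by move: sn => /=; lia.
  case=> js jk sjs.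
  have js_map : map uphalf (map pair_sum js) = js.
    rewrite -map_comp -[RHS]map_id; apply/eq_in_map => j /(allP jk) /=.
    by case/andP=> j0 _; apply: pair_sumK.
  have lam_perm : perm_eq (sort geq (map pair_sum js)) (map pair_sum js).
    by rewrite perm_sort.
  have s_perm : perm_eq s (pairs_union (map uphalf (sort geq (map pair_sum js)))).
    rewrite (permPl sjs) perm_sym /pairs_union.
    rewrite -{2}js_map; apply/perm_flatten/perm_map/perm_map.
    exact: lam_perm.
  have olam : all odd (sort geq (map pair_sum js)).
    rewrite all_sort all_map; apply: sub_all jk => j /=; rewrite /pair_sum; lia.
  exists (k, sort geq (map pair_sum js)) => /=.
    split=> //=.
    + rewrite /is_intpart (sort_sorted geq_total) /= all_sort all_map.
      by apply: sub_all jk => j /=; rewrite /pair_sum; lia.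
    + rewrite all_sort all_map; apply: sub_all jk => j /=; rewrite /pair_sum; lia.
    + by rewrite -sn /= (perm_sumn s_perm) sumn_pairs_union.
  rewrite /h; congr cons; apply: perm_sorted_geq => /=.
  + exact/sort_sorted/geq_total.
  + exact: path_sorted smu.
  + by rewrite perm_sort perm_sym.
Qed.

(** * Odd Ferrers diagrams *)

Lemma two_modularK lam : is_intpart lam -> map sumn (two_modular lam) = lam.
Proof.
case/andP=> _ pos; rewrite -map_comp -[RHS]map_id; apply/eq_in_map => p p_lam.
exact/sumn_two_modular_row/(allP pos).
Qed.

Lemma mem_two_modular_row m : odd m -> (2%N \in two_modular_row m) = (1 < m)%N.
Proof.
rewrite /two_modular_row => mo; rewrite mo inE /= mem_nseq eqxx andbT.
by case: m mo => [|[|[|m]]].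
Qed.

(** A row that represents the odd part p has (p + 1)/2 boxes, so the row lengths
    weakly decrease from the first row on exactly when p <= 2k - 1.  Such a row
    is a 1 followed by 2s, so it contains a 2 exactly when p > 1. *)
Lemma sum_odd_ferrers n :
  \sum_(F \in odd_ferrers n) (rows_with_2 F)%:Z
    = \sum_(F \in odd_ferrers_pairs n) (parts_gt1 F.2)%:Z.
Proof.
pose h (F : nat * seq nat) := nseq F.1 1%N :: two_modular F.2.
have size_h F : is_intpart F.2 -> diagram_size (h F) = (F.1 + sumn F.2)%N.
  by move=> FP; rewrite /diagram_size /= sumn_nseq mul1n two_modularK.
have shape_h k lam : is_intpart lam -> all odd lam ->
    sorted geq (shape (h (k, lam))) = all (fun p => p <= 2 * k - 1)%N lam.
  case/andP=> slam plam olam.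
  have -> : shape (h (k, lam)) = k :: map uphalf lam.
    rewrite /shape /= size_nseq -map_comp; congr cons; apply/eq_in_map => p pl /=.
    by rewrite size_nseq; have := allP plam p pl; lia.
  rewrite /= (path_sortedE geq_trans) all_map.
  rewrite sorted_map (sub_sorted _ slam) ?andbT; last by move=> p q /= qp; lia.
  by apply: eq_in_all => p pl /=; have := allP olam p pl; lia.
rewrite (@reindex_fsbig _ _ _ _ _ h (odd_ferrers_pairs n)).
  apply: eq_fsbigr => F; rewrite inE => -[_ oF _ _].
  rewrite /rows_with_2 /= mem_nseq /= andbF add0n /parts_gt1 count_map.
  congr Posz; apply: eq_in_count => p pF /=.
  exact/mem_two_modular_row/(allP oF).
split.
- move=> [k lam] [lamP olam llam sz]; split; last by rewrite size_h.
  by split; [rewrite shape_h | exists k, lam].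
- move=> [k lam] [j mu]; rewrite !inE => -[/= lamP _ _ _] [/= muP _ _ _].
  case=> /(congr1 size); rewrite !size_nseq => -> eq_rows.
  by rewrite -(two_modularK lam) // eq_rows two_modularK.
- move=> F [[sF [k [lam [lamP olam FE]]]] sz]; exists (k, lam) => //.
  split=> //=; first by rewrite -(shape_h k) // /h -FE.
  by rewrite -(size_h (k, lam)) // /h -FE.
Qed.

(** * The excess of parts *)

Theorem theorem3p2 (n : nat) (hn : (1 <= n)%N) :
  \sum_(mu \in A_omega n) (size mu)%:Z - \sum_(mu \in B_omega n) (size mu)%:Z
    = \sum_(F \in odd_ferrers n) (rows_with_2 F)%:Z
  /\
  \sum_(F \in odd_ferrers n) (rows_with_2 F)%:Z
    = \sum_(F \in odd_ferrers_pairs n) (parts_gt1 F.2)%:Z.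
Proof.
split; last exact: sum_odd_ferrers.
rewrite sum_odd_ferrers (sum_A_omega n Posz hn) (sum_B_omega n Posz hn).
rewrite (sum_rooted_pairs_B_ferrers n (fun m => m.+1%:Z)) -odd_ferrers_pairsE //.
under eq_fsbigr do rewrite -addSn PoszD.
rewrite fsbig_split /=; last exact: finite_odd_ferrers_pairs.
by rewrite addrAC subrr add0r.
Qed.
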